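(* Let $\Gamma$ and $\Gamma'$ be two quantum covariance matrices of size $2S\times 2S$ having the same eigenspectrum $\Lambda=(\lambda_i)_{i=1}^{2S}$ (eigenvalues listed with multiplicity in non-ascending order). Suppose that $\Lambda$ satisfies the $(S-1)$-pure unique pairing condition. Then $\Gamma'$ is an orthogonal-symplectic transform of $\Gamma$, i.e. there exists $W\in\mathrm{SpO}(2S,\mathbb{R})$ with $\Gamma'=W\Gamma W^T$.
   Context: Fix an integer $S\ge 1$. Coordinates of $\mathbb{R}^{2S}$ are ordered as $(q_1,p_1,\dots,q_S,p_S)$; coordinates $2i-1$ and $2i$ form the $i$-th mode (a pair of conjugate coordinates). Let $\Omega=\bigoplus_{i=1}^S\begin{pmatrix}0&1\\-1&0\end{pmatrix}$. A real $2S\times 2S$ matrix $A$ is symplectic if $A^T\Omega A=\Omega$. $\mathrm{SpO}(2S,\mathbb{R})$ denotes the group of real $2S\times2S$ matrices that are both orthogonal and symplectic. A quantum covariance matrix (quantum CM) is a real symmetric positive-definite $2S\times 2S$ matrix $\Gamma$ such that the Hermitian matrix $\Gamma+i\Omega$ is positive semidefinite. Let $\Lambda=(\lambda_i)_{i=1}^{2S}$ be the eigenvalues of a quantum CM in non-ascending order. Let $G(\Lambda)$ be the graph with vertex set $\{1,\dots,2S\}$ and edge set $\{\{i,j\}: i<j,\ \lambda_i\lambda_j\ge 1\}$; an edge $\{i,j\}$ is pure if $\lambda_i\lambda_j=1$. $\Lambda$ satisfies the unique pairing condition if $G(\Lambda)$ has a unique perfect matching up to permutations of vertices carrying equal eigenvalues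 (i.e. for any two perfect matchings $M,M'$ there is a permutation $\pi$ of $\{1,\dots,2S\}$ with $\lambda_{\pi(i)}=\lambda_i$ for all $i$ mapping $M$ onto $M'$). $\Lambda$ satisfies the $t$-pure unique pairing condition if it satisfies the unique pairing condition and at least $t$ of the $S$ edges of this perfect matching are pure. *)

(* Defs.v *)
From mathcomp Require Import all_boot all_order all_algebra all_fingroup.
From mathcomp Require Import reals complex.
Set Implicit Arguments. Unset Strict Implicit. Unset Printing Implicit Defensive.
Import Order.TTheory GRing.Theory Num.Theory.
Local Open Scope ring_scope.

(* Coordinates indexed by 'I_(S.*2), 0-based: index 2k is q_(k+1), 2k+1 is p_(k+1).
   Omega = direct sum of S blocks [[0,1],[-1,0]]. *)
Definition Omega (R : nzRingType) (S : nat) : 'M[R]_(S.*2) :=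
  \matrix_(i, j) (if ~~ odd i && (j == i.+1 :> nat) then 1
                  else if odd i && (j.+1 == i :> nat) then -1 else 0).

Definition symplectic (R : nzRingType) (S : nat) (A : 'M[R]_(S.*2)) : Prop :=
  A^T *m Omega R S *m A = Omega R S.

Definition orthogonal_mx (R : nzRingType) (n : nat) (A : 'M[R]_n) : Prop :=
  A^T *m A = 1%:M.

Definition SpO (R : nzRingType) (S : nat) (A : 'M[R]_(S.*2)) : Prop :=
  orthogonal_mx A /\ symplectic A.

Definition herm_psd (R : rcfType) (n : nat) (M : 'M[R[i]]_n) : Prop :=
  (map_mx Num.conj M)^T = M /\
  forall z : 'cV[R[i]]_n, 0 <= ((map_mx Num.conj z)^T *m M *m z) ord0 ord0.

Definition quantum_CM (R : rcfType) (S : nat) (G : 'M[R]_(S.*2)) : Prop :=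
  G^T = G /\
  (forall v : 'cV[R]_(S.*2), v != 0 -> 0 < (v^T *m G *m v) ord0 ord0) /\
  herm_psd (map_mx (fun x : R => (x%:C)%C) G + 'i *: map_mx (fun x : R => (x%:C)%C) (Omega R S)).

Definition spectrum_of (R : rcfType) (n : nat) (G : 'M[R]_n) (Lam : 'I_n -> R) : Prop :=
  (forall i j : 'I_n, (i <= j)%N -> Lam j <= Lam i) /\
  char_poly G = \prod_(i < n) ('X - (Lam i)%:P).

Definition is_edge (R : rcfType) (n : nat) (Lam : 'I_n -> R) (e : {set 'I_n}) : bool :=
  (#|e| == 2) && (1 <= \prod_(k in e) Lam k).

Definition is_pure_edge (R : rcfType) (n : nat) (Lam : 'I_n -> R) (e : {set 'I_n}) : bool :=
  (#|e| == 2) && (\prod_(k in e) Lam k == 1).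

Definition perfect_matching (R : rcfType) (n : nat) (Lam : 'I_n -> R)
    (M : {set {set 'I_n}}) : Prop :=
  (forall e, e \in M -> is_edge Lam e) /\ partition M [set: 'I_n].

Definition unique_pairing (R : rcfType) (n : nat) (Lam : 'I_n -> R) : Prop :=
  (exists M, perfect_matching Lam M) /\
  forall M M', perfect_matching Lam M -> perfect_matching Lam M' ->
    exists pi : 'S_n, (forall i, Lam (pi i) = Lam i) /\
                      M' = [set (pi @: e) | e : {set 'I_n} in M].

Definition t_pure_unique_pairing (R : rcfType) (n : nat) (t : nat) (Lam : 'I_n -> R) : Prop :=
  unique_pairing Lam /\
  exists M, perfect_matching Lam M /\ (t <= #|[set e in M | is_pure_edge Lam e]|)%N.

(* Main.v *)
Require Import Defs.
From mathcomp Require Import all_boot all_order all_algebra all_fingroup.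
From mathcomp Require Import reals complex ring lra zify.
Set Implicit Arguments. Unset Strict Implicit. Unset Printing Implicit Defensive.
Import Order.TTheory GRing.Theory Num.Theory.
Local Open Scope ring_scope.

(** Write A = Omega G^-1 Omega^T; positivity of G + i Omega amounts to A <= G.
    Comparing sorted eigenvalues gives l_i l_(n+1-i) >= 1, so the antidiagonal
    pairing is a perfect matching, hence the unique one, and all but at most one
    of its edges are pure.  A trace (or Rayleigh quotient) argument then yields a
    unit vector u with G u = l_1 u and G (Omega u) = l_n (Omega u).  The plane
    spanned by u and Omega u splits off G and Omega simultaneously, and
    induction brings G to a normal form that depends on its spectrum only. *)

Lemma trmxB (V : zmodType) m n (A B : 'M[V]_(m, n)) : (A - B)^T = A^T - B^T.
Proof. by apply/matrixP => i j; rewrite !mxE. Qed.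

Lemma trmxZ (R : nzRingType) m n a (A : 'M[R]_(m, n)) : (a *: A)^T = a *: A^T.
Proof. by apply/matrixP => i j; rewrite !mxE. Qed.

(** * Euclidean inner product of column vectors *)

Section InnerProduct.
Variable R : rcfType.

Definition dot n (x y : 'cV[R]_n) : R := \sum_i x i 0 * y i 0.

Lemma dotE n (x y : 'cV[R]_n) : x^T *m y = (dot x y)%:M.
Proof.
rewrite [LHS]mx11_scalar; congr (_%:M); rewrite mxE.
by apply: eq_bigr => i _; rewrite mxE.
Qed.

Lemma dot_mxE n (x y : 'cV[R]_n) : (x^T *m y) 0 0 = dot x y.
Proof. by rewrite dotE mxE. Qed.

Lemma dotC n (x y : 'cV[R]_n) : dot x y = dot y x.
Proof. by apply: eq_bigr => i _; rewrite mulrC. Qed.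

Lemma dotDr n (x y z : 'cV[R]_n) : dot x (y + z) = dot x y + dot x z.
Proof. by rewrite -big_split; apply: eq_bigr => i _; rewrite mxE mulrDr. Qed.

Lemma dotZr n a (x y : 'cV[R]_n) : dot x (a *: y) = a * dot x y.
Proof. by rewrite mulr_sumr; apply: eq_bigr => i _; rewrite mxE mulrCA. Qed.

Lemma dotNr n (x y : 'cV[R]_n) : dot x (- y) = - dot x y.
Proof. by rewrite -scaleN1r dotZr mulN1r. Qed.

Lemma dotDl n (x y z : 'cV[R]_n) : dot (x + y) z = dot x z + dot y z.
Proof. by rewrite dotC dotDr ![dot z _]dotC. Qed.

Lemma dotZl n a (x y : 'cV[R]_n) : dot (a *: x) y = a * dot x y.
Proof. by rewrite dotC dotZr dotC. Qed.

Lemma dotNl n (x y : 'cV[R]_n) : dot (- x) y = - dot x y.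
Proof. by rewrite dotC dotNr dotC. Qed.

Lemma dot_mulmx m n (A : 'M[R]_(m, n)) x y : dot x (A *m y) = dot (A^T *m x) y.
Proof. by rewrite -!dot_mxE trmx_mul trmxK mulmxA. Qed.

Lemma dot_delta n (i : 'I_n) (x : 'cV[R]_n) : dot (delta_mx i 0) x = x i 0.
Proof.
rewrite /dot (bigD1 i) //= big1 ?mxE ?eqxx ?mul1r ?addr0 // => j /negPf nji.
by rewrite mxE nji mul0r.
Qed.

Lemma dot_ge0 n (x : 'cV[R]_n) : 0 <= dot x x.
Proof. by apply: sumr_ge0 => i _; rewrite -expr2 sqr_ge0. Qed.

Lemma dot_eq0 n (x : 'cV[R]_n) : (dot x x == 0) = (x == 0).
Proof.
apply/eqP/eqP => [h|->]; last by apply: big1 => i _; rewrite mxE mul0r.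
apply/colP => i; rewrite [RHS]mxE; apply/eqP; rewrite -sqrf_eq0 expr2; apply/eqP.
by apply: (psumr_eq0P _ h) => // j _; rewrite -expr2 sqr_ge0.
Qed.

Lemma dot_col_mx m n (x x' : 'cV[R]_m) (y y' : 'cV[R]_n) :
  dot (col_mx x y) (col_mx x' y') = dot x x' + dot y y'.
Proof.
rewrite /dot big_split_ord /=.
by congr (_ + _); apply: eq_bigr => i _; rewrite ?col_mxEu ?col_mxEd.
Qed.

(** * Orthogonal matrices and completion of orthonormal pairs *)

Lemma orthogonal_mx_dot n (Q : 'M[R]_n) x y :
  orthogonal_mx Q -> dot (Q *m x) (Q *m y) = dot x y.
Proof. by move=> hQ; rewrite dot_mulmx mulmxA hQ mul1mx. Qed.

Lemma orthogonal_mxM n (A B : 'M[R]_n) :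
  orthogonal_mx A -> orthogonal_mx B -> orthogonal_mx (A *m B).
Proof.
by rewrite /orthogonal_mx => hA hB; rewrite trmx_mul mulmxA -(mulmxA B^T) hA mulmx1.
Qed.

Lemma orthogonal_mx_tr n (A : 'M[R]_n) : orthogonal_mx A -> orthogonal_mx A^T.
Proof. by move=> hA; rewrite /orthogonal_mx trmxK; apply: mulmx1C. Qed.

Lemma orthogonal_block n (A : 'M[R]_n) m :
  orthogonal_mx A -> orthogonal_mx (block_mx (1%:M : 'M_m) 0 0 A).
Proof.
rewrite /orthogonal_mx => hA; rewrite tr_block_mx mulmx_block !trmx1 !trmx0.
by rewrite !(mulmx0, mul0mx, addr0, add0r) mulmx1 hA -scalar_mx_block.
Qed.

(** The reflection in the hyperplane orthogonal to [v = u - e] swaps [e] and [u], both being unit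
    vectors. When [u] is already [e] it degenerates and the identity serves. *)
Lemma householder n (u : 'cV[R]_n.+1) : dot u u = 1 ->
  exists2 H : 'M[R]_n.+1, orthogonal_mx H & H *m delta_mx 0 0 = u.
Proof.
move=> u1; set e : 'cV[R]_n.+1 := delta_mx 0 0; pose v := u - e.
have [v0|vN0] := eqVneq v 0.
  exists 1%:M; first by rewrite /orthogonal_mx trmx1 mulmx1.
  by rewrite mul1mx; apply/eqP; rewrite eq_sym -subr_eq0; apply/eqP.
have d0 : dot v v != 0 by rewrite dot_eq0.
have vv : dot v v = - 2 * dot v e.
  have ee : dot e e = 1 by rewrite dot_delta mxE eqxx.
  rewrite /v !(dotDl, dotDr, dotNl, dotNr) u1 ee (dotC e u); ring.
pose P := v *m v^T; have PP : P *m P = dot v v *: P.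
  by rewrite /P mulmxA -(mulmxA v) dotE mul_mx_scalar -scalemxAl.
have PT : P^T = P by rewrite /P trmx_mul trmxK.
exists (1%:M - (2 / dot v v) *: P).
  have HT : (1%:M - (2 / dot v v) *: P)^T = 1%:M - (2 / dot v v) *: P.
    by rewrite trmxB trmxZ trmx1 PT.
  rewrite /orthogonal_mx HT mulmxBl !mulmxBr mul1mx !mulmx1.
  rewrite mul1mx -scalemxAl -scalemxAr PP !scalerA -addrA -opprD -scalerBl.
  rewrite -scalerDl; set c := (X in X *: P); suff -> : c = 0 by rewrite scale0r subr0.
  by rewrite /c; field.
rewrite mulmxBl mul1mx -scalemxAl /P -mulmxA dotE mul_mx_scalar scalerA.
have -> : 2 / dot v v * dot v e = -1.
  by apply: (mulfI d0); rewrite mulrA mulrCA divff // mulr1 mulrN1 vv; ring.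
by rewrite scaleN1r opprK /v addrC subrK.
Qed.

(** A first reflection [H] sends the first basis vector to [u]. The first coordinate of [H^T *m w]
    is [dot u w], hence zero, so a second reflection acting on the other coordinates places [w]
    without disturbing [u]. *)
Lemma orthonormal_pair_completion n (u w : 'cV[R]_(1 + (1 + n))) :
  dot u u = 1 -> dot w w = 1 -> dot u w = 0 ->
  exists Q : 'M[R]_(1 + (1 + n)), [/\ orthogonal_mx Q,
    Q *m delta_mx 0 0 = u & Q *m delta_mx (lift ord0 ord0) 0 = w].
Proof.
move=> u1 w1 uw; have [H Ho He] : exists2 H : 'M[R]_(1 + (1 + n)),
    orthogonal_mx H & H *m delta_mx 0 0 = u by exact: householder.
have HHT : H *m H^T = 1%:M by apply: mulmx1C.
pose w' : 'cV[R]_(1 + (1 + n)) := H^T *m w.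
have w'0 : usubmx w' = 0.
  have e0 : w' 0 0 = 0 by rewrite -dot_delta dot_mulmx trmxK He.
  apply/colP => i; rewrite mxE [RHS]mxE ord1 -[RHS]e0.
  by congr (w' _ _); apply: val_inj.
have w'E : w' = col_mx 0 (dsubmx w') by rewrite -w'0 vsubmxK.
have w'1 : dot (dsubmx w') (dsubmx w') = 1.
  have: dot w' w' = 1 by rewrite {2}/w' dot_mulmx trmxK mulmxA HHT mul1mx.
  by rewrite {1 2}w'E dot_col_mx {1}/dot big1 ?add0r // => i _; rewrite mxE mul0r.
have [H2 Ho2 He2] := householder w'1.
pose B : 'M[R]_(1 + (1 + n)) := block_mx (1%:M : 'M_1) 0 0 (H2 : 'M_(1 + n)).
exists (H *m B).
have split_delta m (i : 'I_(1 + m)) : delta_mx i 0 =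
  col_mx (usubmx (delta_mx i 0)) (dsubmx (delta_mx i 0)) :> 'cV[R]__ by rewrite vsubmxK.
split; first exact: (orthogonal_mxM Ho (orthogonal_block 1 Ho2)).
  rewrite -mulmxA -He; congr (_ *m _); rewrite /B split_delta mul_block_col.
  rewrite (_ : dsubmx _ = 0) ?(mulmx0, mul0mx, addr0, mul1mx) //.
  by apply/colP => i; rewrite !mxE.
rewrite -mulmxA /B split_delta mul_block_col (_ : usubmx _ = 0); last first.
  by apply/colP => i; rewrite !mxE ord1.
rewrite (_ : dsubmx _ = delta_mx 0 0); last first.
  by apply/colP => i; rewrite !mxE; congr (_ && _)%:R.
by rewrite !(mulmx0, mul0mx, add0r) He2 -w'E mulmxA HHT mul1mx.
Qed.

(** * Block splitting and the real spectral theorem *)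

Lemma invariant_block n m (N : 'M[R]_(m + n)) (B : 'M[R]_m) (s : R) :
  N^T = s *: N ->
  (forall j, N *m delta_mx (lshift n j) 0 = col_mx (col j B) 0 :> 'cV_(m + n)) ->
  N = block_mx B 0 0 (drsubmx N).
Proof.
move=> NT Ncol; have lN : lsubmx N = col_mx B 0.
  apply/matrixP => i j; move/colP/(_ i): (Ncol j).
  by rewrite -colE !mxE => ->; case: split => k; rewrite ?mxE.
have NB : ulsubmx N = B.
  by apply/matrixP => i j; move/matrixP/(_ (lshift n i) j): lN; rewrite col_mxEu !mxE.
have N0 : dlsubmx N = 0.
  by apply/matrixP => i j; move/matrixP/(_ (rshift m i) j): lN; rewrite col_mxEd !mxE.
rewrite -{1}[N]submxK NB N0; congr block_mx.
(* Transposition carries the zero lower-left block to the upper right; [s] is 1 for symmetric and -1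
   for skew-symmetric matrices. *)
apply: trmx_inj; rewrite trmx_ursub NT trmx0.
by apply/matrixP => i j; move/matrixP/(_ i j): N0; rewrite !mxE => ->; rewrite mulr0.
Qed.

Lemma char_poly_orthogonal n (Q G : 'M[R]_n) :
  orthogonal_mx Q -> char_poly (Q^T *m G *m Q) = char_poly G.
Proof.
move=> hQ; pose P := map_mx polyC Q.
have PP : P^T *m P = 1%:M by rewrite /P map_trmx -map_mxM hQ map_mx1.
have -> : char_poly (Q^T *m G *m Q) = \det (P^T *m char_poly_mx G *m P).
  rewrite /char_poly /char_poly_mx mulmxBr mulmxBl; congr (\det (_ - _)).
    by rewrite mul_mx_scalar -scalemxAl PP scalemx1.
  by rewrite !map_mxM map_trmx.
by rewrite !det_mulmx mulrC mulrA -det_mulmx (mulmx1C PP) det1 mul1r.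
Qed.

Lemma char_poly_block m n (A : 'M[R]_m) (B : 'M[R]_n) :
  char_poly (block_mx A 0 0 B) = char_poly A * char_poly B.
Proof. by rewrite /char_poly char_block_diag_mx det_ublock. Qed.

Lemma tr_congruence n (Q G : 'M[R]_n) : (Q^T *m G *m Q)^T = Q^T *m G^T *m Q.
Proof. by rewrite !trmx_mul trmxK mulmxA. Qed.

Lemma unit_eigenvector n (G : 'M[R]_n) a : G^T = G -> root (char_poly G) a ->
  exists2 u : 'cV[R]_n, dot u u = 1 & G *m u = a *: u.
Proof.
rewrite -eigenvalue_root_char => GT /eigenvalueP[v vG v0].
pose u := v^T; have Gu : G *m u = a *: u by rewrite -GT -trmx_mul vG trmxZ.
have u0 : 0 < dot u u.
  rewrite lt_def dot_ge0 dot_eq0 andbT.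
  by apply: contra_neq v0 => /(congr1 trmx); rewrite trmxK trmx0.
exists ((Num.sqrt (dot u u))^-1 *: u); last by rewrite -scalemxAr Gu !scalerA mulrC.
rewrite dotZl dotZr mulrA -expr2 exprVn sqr_sqrtr ?ltW //.
by rewrite mulVf // gt_eqF.
Qed.

(** Deflation: a unit eigenvector for [Lam ord0] is rotated to the first basis vector, the matrix
    splits as 1 + n, and the remaining block has the remaining linear factors as characteristic
    polynomial. The factorisation supplies each eigenvalue and fixes its position on the
    diagonal. *)
Lemma real_spectral n (G : 'M[R]_n) (Lam : 'I_n -> R) : G^T = G ->
  char_poly G = \prod_(i < n) ('X - (Lam i)%:P) ->
  exists2 Q, orthogonal_mx Q & Q^T *m G *m Q = diag_mx (\row_i Lam i).
Proof.
elim: n => [|n IHn] in G Lam *; first by exists 1%:M; apply/matrixP; case.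
move=> GT Gchar; have /(unit_eigenvector GT)[u u1 Gu] : root (char_poly G) (Lam ord0).
  by rewrite Gchar big_ord_recl rootM root_XsubC eqxx.
have [H Ho He] : exists2 H : 'M[R]_(1 + n),
    orthogonal_mx H & H *m delta_mx 0 0 = u by exact: householder.
pose N : 'M[R]_(1 + n) := H^T *m G *m H.
have NT : N^T = N by rewrite /N tr_congruence GT.
have Ne : N *m delta_mx 0 0 = Lam ord0 *: delta_mx 0 0 :> 'cV[R]_(1 + n).
  by rewrite /N -mulmxA He -mulmxA Gu -scalemxAr -He mulmxA Ho mul1mx.
have Nb : N = block_mx (Lam ord0)%:M 0 0 (drsubmx N).
  apply: (@invariant_block n 1 N _ 1) => [|j]; first by rewrite scale1r.
  have -> : lshift n j = 0 by apply: val_inj; rewrite /= ord1.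
  rewrite Ne; apply/colP => i; rewrite !mxE.
  by case: splitP => k ik; rewrite !mxE -val_eqE /= ik ?ord1 ?mulr1 ?mulr0.
have N'T : (drsubmx N)^T = drsubmx N by rewrite trmx_drsub NT.
have [|Q Qo QN] := IHn (drsubmx N) (fun i => Lam (lift ord0 i)) N'T.
  apply: (mulfI (monic_neq0 (monicXsubC (Lam ord0)))).
  move: Gchar; rewrite big_ord_recl -(char_poly_orthogonal G Ho) -/N Nb.
  rewrite (@char_poly_block 1 n) block_mxKdr => <-; congr (_ * _).
  by rewrite /char_poly /char_poly_mx det_mx11 !mxE.
exists (H *m (block_mx (1%:M : 'M_1) 0 0 Q : 'M[R]_(1 + n))).
  exact: (orthogonal_mxM Ho (orthogonal_block 1 Qo)).
set B : 'M[R]_(1 + n) := block_mx _ _ _ _.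
have -> : (H *m B)^T *m G *m (H *m B) = B^T *m N *m B by rewrite trmx_mul /N !mulmxA.
rewrite Nb /B tr_block_mx !mulmx_block !trmx0 trmx1.
rewrite !(mulmx0, mul0mx, addr0, add0r, mul1mx, mulmx1) QN.
have -> : \row_i Lam i = row_mx (Lam ord0)%:M (\row_i Lam (lift ord0 i)) :> 'rV_(1 + n).
  apply/rowP => i; rewrite !mxE; case: splitP => j ij; rewrite !mxE.
    by rewrite ord1 eqxx; congr Lam; apply: val_inj; rewrite /= ij ord1.
  by congr Lam; apply: val_inj.
rewrite (@diag_mx_row _ n 1).
have -> // : diag_mx (Lam ord0)%:M = (Lam ord0)%:M :> 'M[R]_1.
by apply/matrixP => i j; rewrite !mxE !ord1.
Qed.

(** * Domination, Rayleigh quotients and the eigenvalue inequality *)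

(** This is z^* (G + i J) z >= 0 for z = x + i y, when J is skew-symmetric. *)
Definition dominated n (J G : 'M[R]_n) :=
  forall x y, 2 * dot x (J *m y) <= dot x (G *m x) + dot y (G *m y).

Lemma dominated_congruence n (Q J G : 'M[R]_n) :
  dominated J G -> dominated (Q^T *m J *m Q) (Q^T *m G *m Q).
Proof.
move=> JG x y; move: (JG (Q *m x) (Q *m y)).
by rewrite -!mulmxA ![dot _ (Q^T *m _)]dot_mulmx trmxK.
Qed.

Lemma dot_diag n (d : 'rV[R]_n) x y :
  dot x (diag_mx d *m y) = \sum_i d 0 i * (x i 0 * y i 0).
Proof. by apply: eq_bigr => i _; rewrite mul_diag_mx mxE mulrCA. Qed.

(** The bound on [d] is asked only on the support of [x], which suits vectors confined to a few
    coordinates. *)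
Lemma dot_diag_le n (d : 'rV[R]_n) (x : 'cV[R]_n) a :
  (forall i, x i 0 != 0 -> d 0 i <= a) -> dot x (diag_mx d *m x) <= a * dot x x.
Proof.
move=> da; rewrite dot_diag mulr_sumr; apply: ler_sum => i _.
have [->|/da] := eqVneq (x i 0) 0; first by rewrite !mulr0.
by apply: ler_wpM2r; rewrite -expr2 sqr_ge0.
Qed.

Lemma dot_diag_ge n (d : 'rV[R]_n) (x : 'cV[R]_n) a :
  (forall i, a <= d 0 i) -> a * dot x x <= dot x (diag_mx d *m x).
Proof.
move=> da; rewrite dot_diag mulr_sumr; apply: ler_sum => i _.
by apply: ler_wpM2r => //; rewrite -expr2 sqr_ge0.
Qed.

(* s = 1 (resp. -1) covers a minimal (resp. maximal) eigenvalue a. *)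
Lemma diag_rayleigh_eq n (d : 'rV[R]_n) (x : 'cV[R]_n) a s : s != 0 ->
  (forall i, 0 <= s * (d 0 i - a)) -> dot x (diag_mx d *m x) = a * dot x x ->
  diag_mx d *m x = a *: x.
Proof.
move=> s0 da xE; apply/colP => i; rewrite mul_diag_mx !mxE.
have sum0 : \sum_i s * (d 0 i - a) * (x i 0 * x i 0) = 0.
  under eq_bigr => j _ do rewrite -mulrA mulrBl.
  by rewrite -mulr_sumr sumrB -mulr_sumr -dot_diag xE subrr mulr0.
have term_ge0 j : true -> 0 <= s * (d 0 j - a) * (x j 0 * x j 0).
  by move=> _; rewrite mulr_ge0 // -expr2 sqr_ge0.
have /eqP := psumr_eq0P term_ge0 sum0 (i := i) isT.
rewrite !mulf_eq0 (negPf s0) /= subr_eq0 orbb.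
by case/orP => /eqP ->; rewrite ?mulr0.
Qed.

(** A dimension count in the manner of Courant and Fischer: it yields [y] with Rayleigh quotient at
    most [Lam (rev_ord i)] such that [K *m y] has Rayleigh quotient at most [Lam i]. Domination
    compares the two. *)
Lemma antidiagonal_ge1 n (K : 'M[R]_n) (Lam : 'I_n -> R) :
  orthogonal_mx K -> dominated K (diag_mx (\row_i Lam i)) ->
  (forall i j : 'I_n, (i <= j)%N -> Lam j <= Lam i) -> (forall i, 0 < Lam i) ->
  forall i, 1 <= Lam i * Lam (rev_ord i).
Proof.
move=> Ko Kdom Lmon Lpos i.
pose f (a : 'I_i.+1) := rev_ord (widen_ord (ltn_ord i) a).
pose g := widen_ord (ltnW (ltn_ord i)).
(* The i + 1 last coordinates against i linear equations: some nonzero y lives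
   on the former while K y vanishes on the first i coordinates. *)
pose B : 'M[R]_(i.+1, i) := \matrix_(a, b) K (g b) (f a).
have /rowV0Pn[c /sub_kermxP cB c0] : kermx B != 0.
  by rewrite -mxrank_eq0 mxrank_ker subn_eq0 -ltnNge ltnS rank_leq_col.
pose E : 'M[R]_(n, i.+1) := \matrix_(j, a) (j == f a)%:R.
have f_inj : injective f by move=> a b /rev_ord_inj /(congr1 val) /= /val_inj.
have Eo : E^T *m E = 1%:M.
  apply/matrixP => a b; rewrite !mxE (bigD1 (f a)) //= big1 => [|j /negPf jf].
    by rewrite !mxE eqxx mul1r addr0 (inj_eq f_inj).
  by rewrite !mxE jf mul0r.
pose y := E *m c^T; pose v := K *m y.
have yy : dot y y = dot c^T c^T by rewrite dot_mulmx mulmxA Eo mul1mx.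
have vv : dot v v = dot y y by rewrite orthogonal_mx_dot.
have yy0 : 0 < dot y y.
  rewrite yy lt_def dot_ge0 dot_eq0 andbT.
  by apply: contra_neq c0 => /(congr1 trmx); rewrite trmxK trmx0.
have KE b a : (K *m E) b a = K b (f a).
  rewrite mxE (bigD1 (f a)) //= big1 => [|j /negPf jf]; rewrite mxE ?eqxx ?mulr1 ?addr0 //.
  by rewrite jf mulr0.
have v0 j : v j 0 != 0 -> (i <= j)%N.
  apply: contraNleq => ji; apply/eqP.
  have cBj : (c *m B) 0 (Ordinal ji) = 0 by rewrite cB mxE.
  rewrite -cBj /v /y mulmxA mxE [RHS]mxE; apply: eq_bigr => a _.
  rewrite KE !mxE mulrC; congr (_ * K _ _); exact: val_inj.
have y0 j : y j 0 != 0 -> (rev_ord i <= j)%N.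
  apply: contraNleq => ji; rewrite mxE big1 // => a _; rewrite !mxE.
  case: eqP => [jE|_]; last by rewrite mul0r.
  by move: ji; rewrite jE /= ltnNge leq_sub2l // ltn_ord.
set l := Lam i; set l' := Lam (rev_ord i); have l'0 : 0 < l' := Lpos _.
have vD : dot v (diag_mx (\row_i Lam i) *m v) <= l * dot y y.
  by rewrite -vv; apply: dot_diag_le => j /v0 /Lmon; rewrite mxE.
have yD : dot y (diag_mx (\row_i Lam i) *m y) <= l' * dot y y.
  by apply: dot_diag_le => j /y0 /Lmon; rewrite mxE.
(* The scale [l'^-1] turns the inequality into 2 / l' <= l + 1 / l' after division by [dot y y]. *)
have := Kdom v (l'^-1 *: y); rewrite -!scalemxAr !(dotZl, dotZr) -/v vv => dom.
have: 2 * (l'^-1 * dot y y) <= l * dot y y + l'^-1 * dot y y.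
  apply: (le_trans dom); rewrite lerD // ler_pM2l ?invr_gt0 //.
  by rewrite -[leRHS](mulKf (lt0r_neq0 l'0)) ler_pM2l ?invr_gt0.
rewrite mulrA -mulrDl ler_pM2r // mulr_natl mulr2n lerD2r => h.
by rewrite -(@ler_pM2r _ l'^-1) ?invr_gt0 // mul1r mulfK // lt0r_neq0.
Qed.

(** * Eigenvectors for the outer pair of eigenvalues *)

Lemma mxtrace_congruence n (Q M : 'M[R]_n) :
  orthogonal_mx Q -> \tr (Q^T *m M *m Q) = \tr M.
Proof. by move=> hQ; rewrite mxtrace_mulC mulmxA (mulmx1C hQ) mul1mx. Qed.

(** In an orthonormal basis beginning with [u] and [w], the trace is the sum of the values of the
    form, all nonnegative. Dimensions 0 and 1 contain no orthonormal pair. *)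
Lemma psd_trace_ge n (M : 'M[R]_n) u w : (forall x, 0 <= dot x (M *m x)) ->
  dot u u = 1 -> dot w w = 1 -> dot u w = 0 ->
  dot u (M *m u) + dot w (M *m w) <= \tr M.
Proof.
case: n M u w => [|[|n]] M u w Mpsd u1 w1 uw.
- by move: u1; rewrite /dot big_ord0 => /esym/eqP; rewrite oner_eq0.
- move: u1 w1 uw; rewrite /dot !big_ord1 => u1 w1 uw.
  move: (congr2 *%R u1 w1); rewrite mulrACA uw mul0r mulr1 => /esym/eqP.
  by rewrite oner_eq0.
have [Q [Qo <- <-]] := @orthonormal_pair_completion n u w u1 w1 uw.
rewrite -(mxtrace_congruence M Qo) /mxtrace.
have QE i : (Q^T *m M *m Q) i i = dot (Q *m delta_mx i 0) (M *m (Q *m delta_mx i 0)).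
  have -> : (Q^T *m M *m Q) i i = dot (delta_mx i 0) (Q^T *m M *m Q *m delta_mx i 0).
    by rewrite dot_delta -colE [RHS]mxE.
  by rewrite -!mulmxA dot_mulmx trmxK.
rewrite !big_ord_recl !QE addrA ler_wpDr //.
by apply: sumr_ge0 => i _; rewrite QE.
Qed.

Lemma skew_dot n (J : 'M[R]_n) x : J^T = - J -> dot x (J *m x) = 0.
Proof.
move=> JT; have : dot x (J *m x) = - dot x (J *m x).
  by rewrite {1}dot_mulmx JT mulNmx dotNl dotC.
lra.
Qed.

Lemma outer_pair_diag n (K : 'M[R]_n.+1) (Lam : 'I_n.+1 -> R) :
  let D := diag_mx (\row_i Lam i) in
  K^T = - K -> orthogonal_mx K -> dominated K D ->
  (forall i j : 'I_n.+1, (i <= j)%N -> Lam j <= Lam i) -> (forall i, 0 < Lam i) ->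
  Lam ord0 * Lam ord_max = 1 \/
    (forall i, i != ord0 -> i != ord_max -> Lam i * Lam (rev_ord i) = 1) ->
  exists u, [/\ dot u u = 1, D *m u = Lam ord0 *: u
              & D *m (K *m u) = Lam ord_max *: (K *m u)].
Proof.
move=> D KT Ko Kdom Lmon Lpos pure.
have KKT : K *m K^T = 1%:M := mulmx1C Ko.
have KK x : K *m (K *m x) = - x :> 'cV_n.+1.
  by rewrite -[RHS]mul1mx -KKT KT -mulmxA mulmxN mulNmx opprK.
have Kdot x y : dot (K *m x) (K *m y) = dot x y := orthogonal_mx_dot x y Ko.
have ee (i : 'I_n.+1) : dot (delta_mx i 0) (delta_mx i 0) = 1 :> R.
  by rewrite dot_delta mxE !eqxx.
have De i : D *m delta_mx i 0 = Lam i *: (delta_mx i 0 : 'cV_n.+1).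
  apply/colP => j; rewrite mul_diag_mx !mxE.
  by case: eqP => [->|_]; rewrite ?mulr0.
have Lmax i : Lam i <= Lam ord0 by exact: Lmon.
have Lmin i : Lam ord_max <= Lam i by apply: Lmon; rewrite -ltnS ltn_ord.
set l0 := Lam ord0 in pure Lmax *; set lm := Lam ord_max in pure Lmin *.
have l0_gt0 : 0 < l0 := Lpos _.
have lm_gt0 : 0 < lm := Lpos _.
have [pure0|impure0] := eqVneq (l0 * lm) 1.
  (* Here w = K e_max satisfies 1 / lm <= w^T D w <= l0, so equality holds. *)
  pose w : 'cV[R]_n.+1 := K *m delta_mx ord_max 0.
  have ww : dot w w = 1 by rewrite Kdot ee.
  exists w; split => //; last by rewrite KK mulmxN De scalerN.
  apply: (@diag_rayleigh_eq _ _ _ _ (-1)); first by rewrite oppr_eq0 oner_eq0.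
    by move=> i; rewrite mxE mulN1r opprB subr_ge0.
  apply/le_anti/andP; split; first by apply: dot_diag_le => i _; rewrite mxE.
  (* As [l0 = 1 / lm], the two sides become [2 * l0] and [dot w (D *m w) + l0]. *)
  have := Kdom w (l0 *: delta_mx ord_max 0).
  rewrite -!scalemxAr De !(dotZl, dotZr) -/w ww ee -/lm -/D.
  by rewrite !mulr1 pure0 mulr1; lra.
have {}pure i : i != ord0 -> i != ord_max -> Lam i * Lam (rev_ord i) = 1.
  by case: pure => [p0|]; [rewrite p0 eqxx in impure0 | apply].
(* The trace of the positive semidefinite D - A bounds its values at u = e_0
   and w = K u; all other pairs being pure, this leaves w^T D w <= lm. *)
pose u : 'cV[R]_n.+1 := delta_mx ord0 0; pose w : 'cV[R]_n.+1 := K *m u.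
have ww : dot w w = 1 by rewrite Kdot ee.
have uw : dot u w = 0 := skew_dot u KT.
(* In dimension one the unit vector [w] would be a multiple of [u], although orthogonal to it. *)
have neq0m : ord0 != ord_max :> 'I_n.+1.
  apply: contra_eq_neq ww => i0.
  have -> : w = w ord0 0 *: u.
    apply/colP => i; have -> : i = ord0.
      by apply: val_inj; have := ltn_ord i; move: (congr1 val i0) => /=; lia.
    by rewrite !mxE eqxx mulr1.
  by rewrite dotZl -dot_delta -/u uw mul0r eq_sym oner_neq0.
pose D' : 'M[R]_n.+1 := diag_mx (\row_i (Lam i)^-1).
have DD' x : D *m (D' *m x) = x :> 'cV_n.+1.
  by apply/colP => i; rewrite !mul_diag_mx !mxE mulVKf // lt0r_neq0.
pose A := K *m D' *m K^T.
have Adot x : dot x (A *m x) = dot (K^T *m x) (D' *m (K^T *m x)).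
  by rewrite /A -!mulmxA dot_mulmx.
(* Domination at [x] and [D' *m (K^T *m x)] bounds twice the form of [A] by the form of [D] plus
   that of [A]. *)
have Mpsd x : 0 <= dot x ((D - A) *m x).
  rewrite mulmxBl dotDr dotNr subr_ge0.
  have := Kdom x (D' *m (K^T *m x)); rewrite DD' [dot x (K *m _)]dot_mulmx Adot.
  by rewrite [dot (D' *m _) _]dotC; lra.
have KTu : K^T *m u = - w by rewrite KT mulNmx.
have KTw : K^T *m w = u by rewrite mulmxA Ko mul1mx.
have := psd_trace_ge Mpsd (ee _) ww uw.
(* The trace of [A] is the sum of the inverse eigenvalues. Reversing that sum puts the inverse of
   [Lam (rev_ord i)] against [Lam i], and purity cancels all but the two outer terms. *)
have trM : \tr (D - A) = (l0 - lm^-1) + (lm - l0^-1).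
  rewrite linearB /= [\tr A]mxtrace_mulC mulmxA Ko mul1mx !mxtrace_diag.
  rewrite [X in _ - X](reindex_inj rev_ord_inj) -sumrB.
  rewrite (bigD1 ord0) //= (bigD1 ord_max) 1?eq_sym //= big1 ?addr0.
    rewrite !mxE; congr (_ - (Lam _)^-1 + (_ - (Lam _)^-1)); apply: val_inj => //=.
      by rewrite subn1.
    by rewrite subnn.
  move=> i /andP[i0 im]; rewrite !mxE -[X in X - _](mulfK (lt0r_neq0 (Lpos (rev_ord i)))).
  by rewrite pure // mul1r subrr.
rewrite trM !mulmxBl !dotDr !dotNr !Adot KTu KTw De mulmxN dotNl dotNr opprK.
have -> : dot u (D' *m u) = l0^-1 by rewrite dot_delta mul_diag_mx !mxE eqxx mulr1.
rewrite dotZr ee mulr1 -/l0 => tr_le.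
(* With this bound [tr_le] gives [dot w (D *m w) <= lm]; as [lm] is the least eigenvalue, equality
   holds and [w] is an eigenvector. *)
have wD'w : dot w (D' *m w) <= lm^-1.
  rewrite -[leRHS]mulr1 -ww; apply: dot_diag_le => i _.
  by rewrite mxE lef_pV2 ?posrE.
have wDw : lm <= dot w (D *m w).
  by rewrite -[leLHS]mulr1 -ww; apply: dot_diag_ge => i; rewrite mxE.
exists u; split; [exact: ee | exact: De |].
apply: (@diag_rayleigh_eq _ _ _ _ 1); first exact: oner_neq0.
  by move=> i; rewrite mxE mul1r subr_ge0.
by rewrite -/w ww -/D; lra.
Qed.

(** Diagonalising [G] by an orthogonal [Q] replaces [J] by [Q^T *m J *m Q], which is still skew,
    orthogonal and dominated, so the diagonal case applies. *)
Lemma outer_pair n (J G : 'M[R]_n.+1) (Lam : 'I_n.+1 -> R) :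
  J^T = - J -> orthogonal_mx J -> G^T = G -> dominated J G -> spectrum_of G Lam ->
  (forall i, 0 < Lam i) ->
  Lam ord0 * Lam ord_max = 1 \/
    (forall i, i != ord0 -> i != ord_max -> Lam i * Lam (rev_ord i) = 1) ->
  exists u, [/\ dot u u = 1, G *m u = Lam ord0 *: u
              & G *m (J *m u) = Lam ord_max *: (J *m u)].
Proof.
move=> JT Jo GT Jdom [Lmon Gchar] Lpos pure; have [Q Qo QG] := real_spectral GT Gchar.
have QQT : Q *m Q^T = 1%:M := mulmx1C Qo.
have QoT : orthogonal_mx Q^T by rewrite /orthogonal_mx trmxK.
have := dominated_congruence Q Jdom; rewrite QG => Kdom.
have KT : (Q^T *m J *m Q)^T = - (Q^T *m J *m Q).
  by rewrite tr_congruence JT mulmxN mulNmx.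
have Ko : orthogonal_mx (Q^T *m J *m Q) by do 2?apply: orthogonal_mxM.
have [u [u1 Du DKu]] := outer_pair_diag KT Ko Kdom Lmon Lpos pure.
have GQ x : G *m (Q *m x) = Q *m (diag_mx (\row_i Lam i) *m x).
  by rewrite -QG !mulmxA QQT mul1mx.
exists (Q *m u); split; first by rewrite orthogonal_mx_dot.
  by rewrite GQ Du scalemxAr.
have JQ : J *m (Q *m u) = Q *m (Q^T *m J *m Q *m u) by rewrite !mulmxA QQT mul1mx.
by rewrite JQ GQ DKu -scalemxAr.
Qed.
End InnerProduct.

(** * Simultaneous normal form of the skew form and the covariance matrix *)

Section NormalForm.
Variable R : rcfType.

Lemma Omega_block S :
  Omega R S.+1 = block_mx (Omega R 1) 0 0 (Omega R S) :> 'M_(2 + S.*2).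
Proof.
apply/matrixP => i j; rewrite !mxE.
case: splitP => i' /= ii'; rewrite !mxE; case: splitP => j' /= jj'; rewrite !mxE.
- by rewrite ii' jj'.
- by rewrite ii' jj'; case: i' {ii'} => [[|[|//]] ?].
- rewrite ii' jj'; case: j' {jj'} => [[|[|//]] ?] /=; first by rewrite !andbF.
  by case: i' {ii'} => [[|k] ?]; rewrite /= ?andbF.
- by rewrite ii' jj' !add2n /= !negbK !eqSS.
Qed.

Lemma Omega_skew S : (Omega R S)^T = - Omega R S.
Proof.
apply/matrixP => i j; rewrite !mxE.
by repeat (case: ifPn => ?); rewrite ?(opprK, oppr0) //; exfalso; lia.
Qed.

Lemma Omega_orthogonal S : orthogonal_mx (Omega R S).
Proof.
elim: S => [|S IHS]; first by apply/matrixP; case.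
suff: orthogonal_mx (block_mx (Omega R 1) 0 0 (Omega R S) : 'M_(2 + S.*2)).
  by rewrite (Omega_block S).
rewrite /orthogonal_mx tr_block_mx mulmx_block !trmx0.
rewrite !(mulmx0, mul0mx, addr0, add0r) IHS [RHS](@scalar_mx_block _ 2 S.*2).
congr block_mx; apply/matrixP => i j; rewrite !mxE !big_ord_recl big_ord0 !mxE.
by case: i => [[|[|//]] ?]; case: j => [[|[|//]] ?];
  rewrite /= !(mulr0, mul0r, addr0, add0r, mulrNN, mulr1).
Qed.

(* J is arbitrary because the block complementary to the split-off plane need not be
   Omega; D is chosen before J and G, hence depends on Lam only. *)
Lemma normal_form S (Lam : 'I_(S.*2) -> R) :
  (forall i j, Lam i * Lam (rev_ord i) != 1 -> Lam j * Lam (rev_ord j) != 1 ->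
     j = i \/ j = rev_ord i) -> (forall i, 0 < Lam i) ->
  exists D : 'M[R]_(S.*2), forall J G : 'M[R]_(S.*2),
    J^T = - J -> orthogonal_mx J -> G^T = G -> dominated J G -> spectrum_of G Lam ->
    exists Q, [/\ orthogonal_mx Q, Q^T *m J *m Q = Omega R S & Q^T *m G *m Q = D].
Proof.
elim: S Lam => [|S IHS] Lam impure Lpos.
  by exists 0 => J G _ _ _ _ _; exists 1%:M; split; apply/matrixP; case.
pose n := S.*2.
(* [mid] skips the first and the last index, so it commutes with reversal and keeps the antidiagonal
   pairs. *)
pose mid (i : 'I_n) : 'I_n.+2 := lift ord0 (widen_ord (leqnSn n) i).
have rev_mid i : rev_ord (mid i) = mid (rev_ord i).
  by apply: val_inj; rewrite /= /bump /=; have := ltn_ord i; lia.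
have [|i|D' IH] := IHS (fun i => Lam (mid i)).
- move=> i j; rewrite -!rev_mid => ni nj.
  by case: (impure _ _ ni nj) => [|]; rewrite ?rev_mid => /(congr1 val) [] ij;
    [left | right]; apply: val_inj.
- exact: Lpos.
pose B : 'M[R]_2 := diag_mx (\row_i if i == 0 then Lam ord0 else Lam ord_max).
exists (block_mx B 0 0 D' : 'M_(2 + n)) => J G JT Jo GT Jdom Gspec.
have rev0 : rev_ord ord0 = ord_max :> 'I_n.+2 by apply: val_inj; rewrite /= subn1.
(* If the outer pair is impure, [impure] confines every impure index to that pair. *)
have pure : Lam ord0 * Lam ord_max = 1 \/
    (forall i, i != ord0 -> i != ord_max -> Lam i * Lam (rev_ord i) = 1).
  have [|ne1] := eqVneq (Lam ord0 * Lam ord_max) 1; [by left | right => i i0 im].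
  apply/eqP; apply: contraNT i0 => ni.
  have := impure ord0 i; rewrite rev0 => /(_ ne1 ni) [/eqP //|/eqP].
  by rewrite (negPf im).
have [u [u1 Gu GJu]] := @outer_pair R n.+1 J G Lam JT Jo GT Jdom Gspec Lpos pure.
(* The sign gives [J *m u = - w] and [J *m w = u], the action of [Omega R 1] on its two basis
   vectors. *)
pose w := - (J *m u).
have uw : dot u w = 0 by rewrite dotNr skew_dot ?oppr0.
have ww : dot w w = 1 by rewrite dotNl dotNr opprK orthogonal_mx_dot.
have Jw : J *m w = u.
  by rewrite /w mulmxN -mulNmx -JT mulmxA Jo mul1mx.
have Gw : G *m w = Lam ord_max *: w by rewrite mulmxN GJu scalerN.
have [Q [Qo Qu Qw]] := @orthonormal_pair_completion R n u w u1 ww uw.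
have eE (j : 'I_2) : Q *m delta_mx (lshift n j) 0 = (if j == 0 then u else w).
  rewrite -Qu -Qw; case: j => [[|[|//]] lt] /=; congr (_ *m delta_mx _ _); exact: val_inj.
pose N : 'M[R]_(2 + n) := Q^T *m G *m Q; pose K : 'M[R]_(2 + n) := Q^T *m J *m Q.
have QTu : Q^T *m u = delta_mx (lshift n 0) 0 :> 'cV_(2 + n).
  by rewrite -[RHS]mul1mx -Qo -mulmxA eE.
have QTw : Q^T *m w = delta_mx (lshift n 1) 0 :> 'cV_(2 + n).
  by rewrite -[RHS]mul1mx -Qo -mulmxA eE.
have colE2 (j : 'I_2) (M : 'M[R]_2) :
   col_mx (col j M) 0 = M 0 j *: delta_mx (lshift n 0) 0
     + M 1 j *: delta_mx (lshift n 1) 0 :> 'cV_(2 + n).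
  apply/colP => i; rewrite !mxE.
  case: splitP => k ik; rewrite !mxE -!val_eqE /= ik.
    case: k {ik} => [[|[|//]] lt] /=; rewrite ?mulr1 ?mulr0 ?addr0 ?add0r;
      by congr (M _ _); apply: val_inj.
  by rewrite !mulr0 addr0.
have NT : N^T = 1 *: N by rewrite tr_congruence GT scale1r.
have KT : K^T = -1 *: K by rewrite tr_congruence JT mulmxN mulNmx scaleN1r.
have Nb : N = block_mx B 0 0 (drsubmx N).
  apply: (invariant_block NT) => j; rewrite colE2 /N -!mulmxA eE !mxE.
  by case: j => [[|[|//]] lt] /=; rewrite ?Gu ?Gw -scalemxAr ?QTu ?QTw;
    rewrite ?mulr1n ?mulr0n ?scale0r ?addr0 ?add0r.
have Kb : K = block_mx (Omega R 1) 0 0 (drsubmx K).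
  apply: (invariant_block KT) => j; rewrite colE2 /K -!mulmxA eE !mxE.
  case: j => [[|[|//]] lt] /=; rewrite ?Jw ?QTu ?scale0r ?scale1r ?addr0 ?add0r //.
  have -> : J *m u = - w by rewrite opprK.
  by rewrite mulmxN QTw scaleN1r.
set J' := drsubmx K in Kb; set G' := drsubmx N in Nb.
have J'T : J'^T = - J'.
  by rewrite /J' trmx_drsub KT scaleN1r; apply/matrixP => i j; rewrite !mxE.
have G'T : G'^T = G' by rewrite /G' trmx_drsub NT scale1r.
have Ko : orthogonal_mx K.
  apply: orthogonal_mxM => //; apply: orthogonal_mxM => //.
  exact: orthogonal_mx_tr.
have J'o : orthogonal_mx J'.
  move: Ko; rewrite /orthogonal_mx Kb tr_block_mx mulmx_block !trmx0.
  rewrite !(mulmx0, mul0mx, addr0, add0r) [RHS](@scalar_mx_block _ 2 n).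
  by case/eq_block_mx.
have J'dom : dominated J' G'.
  have KN : dominated K N := dominated_congruence Q Jdom.
  move=> x y; have := KN (col_mx (0 : 'cV_2) x) (col_mx (0 : 'cV_2) y).
  rewrite Kb Nb !mul_block_col !(mulmx0, mul0mx, addr0, add0r) !dot_col_mx.
  have d0 : dot (0 : 'cV[R]_2) 0 = 0 by rewrite /dot big1 // => i _; rewrite mxE mul0r.
  by rewrite !d0 !add0r.
have G'spec : spectrum_of G' (fun i => Lam (mid i)).
  case: Gspec => Lmon Gchar; split=> [i j ij|]; first by apply: Lmon.
  have B0 : char_poly B != 0 by exact: monic_neq0 (char_poly_monic B).
  apply: (mulfI B0).
  have <- : char_poly G = char_poly B * char_poly G'.
    by rewrite -(char_poly_orthogonal G Qo) -/N Nb (@char_poly_block _ 2 n).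
  (* The first and last factors of the product are exactly those of [char_poly B]. *)
  rewrite Gchar [LHS]big_ord_recl big_ord_recr /= char_poly_trig ?diag_mx_is_trig //.
  rewrite !big_ord_recl big_ord0 !mxE !eqxx /= mulr1n mulr1 [X in _ * X]mulrC mulrA.
  by congr (_ * ('X - (Lam _)%:P) * _); apply: val_inj.
have [Q' [Q'o Q'J Q'G]] := IH J' G' J'T J'o G'T J'dom G'spec.
pose P : 'M[R]_(2 + n) := block_mx 1%:M 0 0 Q'.
have PM (M : 'M[R]_2) M' : P^T *m block_mx M 0 0 M' *m P = block_mx M 0 0 (Q'^T *m M' *m Q').
  rewrite /P tr_block_mx !mulmx_block !trmx0 trmx1.
  by rewrite !(mulmx0, mul0mx, addr0, add0r, mul1mx, mulmx1).
have QP M : (Q *m P)^T *m M *m (Q *m P) = P^T *m (Q^T *m M *m Q) *m P.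
  by rewrite trmx_mul !mulmxA.
exists (Q *m P); split; first exact: (orthogonal_mxM Qo (orthogonal_block 2 Q'o)).
  by rewrite QP -/K Kb PM Q'J (Omega_block S).
by rewrite QP -/N Nb PM Q'G.
Qed.
End NormalForm.

(** * The antidiagonal pairing as a perfect matching *)

Section Matching.
Variables (R : rcfType) (S : nat) (Lam : 'I_(S.*2) -> R).

Let anti (i : 'I_(S.*2)) : {set 'I_(S.*2)} := [set i; rev_ord i].

Lemma rev_ord_double_neq (i : 'I_(S.*2)) : rev_ord i != i.
Proof. by rewrite -val_eqE /=; have := ltn_ord i; lia. Qed.

Lemma anti_mem i k : k \in anti i -> anti k = anti i.
Proof. by rewrite in_set2 => /orP[] /eqP -> //; rewrite /anti rev_ordK setUC. Qed.

Lemma card_anti i : #|anti i| = 2.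
Proof. by rewrite cards2 eq_sym rev_ord_double_neq. Qed.

Lemma prod_anti i : \prod_(k in anti i) Lam k = Lam i * Lam (rev_ord i).
Proof. by rewrite big_setU1 ?big_set1 // inE eq_sym rev_ord_double_neq. Qed.

Lemma antidiagonal_partition : partition [set anti i | i : 'I_(S.*2)] setT.
Proof.
apply/and3P; split.
- apply/eqP/setP => i; rewrite inE; apply/bigcupP; exists (anti i); last exact: set21.
  exact: imset_f.
- apply/trivIsetP => _ _ /imsetP[i _ ->] /imsetP[j _ ->]; apply: contraR.
  by case/pred0Pn => k /andP[/= /anti_mem <- /anti_mem <-].
- apply/imsetP => -[i _ /(congr1 (fun A : {set _} => #|A|))].
  by rewrite cards0 card_anti.
Qed.

Lemma antidiagonal_matching : (forall i, 1 <= Lam i * Lam (rev_ord i)) ->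
  perfect_matching Lam [set anti i | i : 'I_(S.*2)].
Proof.
move=> ge1; split; last exact: antidiagonal_partition.
by move=> _ /imsetP[i _ ->]; rewrite /is_edge card_anti eqxx prod_anti ge1.
Qed.

(** Uniqueness carries the given matching onto the antidiagonal one by a permutation preserving
    [Lam], so pure edges stay pure. At least [S.-1] of the [S] antidiagonal edges are then pure, and
    two impure indices must share an edge. *)
Lemma antidiagonal_impure_unique : (forall i, 1 <= Lam i * Lam (rev_ord i)) ->
  t_pure_unique_pairing S.-1 Lam -> forall i j,
  Lam i * Lam (rev_ord i) != 1 -> Lam j * Lam (rev_ord j) != 1 ->
  j = i \/ j = rev_ord i.
Proof.
move=> ge1 [[_ uniqM] [M [Mpm Mpure]]] i j ni nj.
have [p [Lp]] := uniqM _ _ Mpm (antidiagonal_matching ge1).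
set M0 := [set anti i | i : _] => M0E.
have cardM0 : (#|M0| * 2 = S.*2)%N.
  rewrite -(card_uniform_partition _ antidiagonal_partition) ?cardsT ?card_ord //.
  by move=> _ /imsetP[k _ ->]; apply: card_anti.
have pure_image e : is_pure_edge Lam e -> is_pure_edge Lam (p @: e).
  case/andP => /eqP e2 /eqP e1; rewrite /is_pure_edge card_imset ?e2 ?eqxx //=;
    last exact: perm_inj.
  rewrite big_imset /=; last by move=> a b _ _; apply: perm_inj.
  by under eq_bigr => k _ do rewrite Lp; rewrite e1.
have pure_ge : (S.-1 <= #|[set e in M0 | is_pure_edge Lam e]|)%N.
  apply: (leq_trans Mpure).
  rewrite -(card_imset (mem [set e in M | is_pure_edge Lam e]) (imset_inj (@perm_inj _ p))).
  apply: subset_leq_card; apply/subsetP => f /imsetP[e]; rewrite inE => /andP[eM ep] ->.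
  by rewrite inE pure_image // M0E imset_f.
have impure_le : (#|[set e in M0 | ~~ is_pure_edge Lam e]| <= 1)%N.
  have := cardsID [set e | is_pure_edge Lam e] M0.
  have -> : M0 :&: [set e | is_pure_edge Lam e] = [set e in M0 | is_pure_edge Lam e].
    by apply/setP => e; rewrite !inE.
  have -> : M0 :\: [set e | is_pure_edge Lam e] = [set e in M0 | ~~ is_pure_edge Lam e].
    by apply/setP => e; rewrite !inE andbC.
  by move: pure_ge cardM0; lia.
have impure k : Lam k * Lam (rev_ord k) != 1 ->
    anti k \in [set e in M0 | ~~ is_pure_edge Lam e].
  by move=> nk; rewrite inE imset_f //= /is_pure_edge prod_anti negb_and nk orbT.
have: j \in anti i.
  by rewrite -(card_le1_eqP impure_le _ _ (impure i ni) (impure j nj)) set21.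
by rewrite in_set2 => /orP[] /eqP; [left | right].
Qed.

End Matching.

(** * From complex positivity to real domination *)

Lemma mulmx_conjugate_expand (F : comNzRingType) n (k : F) (a b : 'cV[F]_n) (M N : 'M[F]_n) :
  ((a - k *: b)^T *m (M + k *: N) *m (a + k *: b)) 0 0 =
    (a^T *m M *m a) 0 0 - k ^+ 2 * (b^T *m M *m b) 0 0
    + k ^+ 2 * ((a^T *m N *m b) 0 0 - (b^T *m N *m a) 0 0)
    + k * ((a^T *m M *m b) 0 0 - (b^T *m M *m a) 0 0 + (a^T *m N *m a) 0 0
           - k ^+ 2 * (b^T *m N *m b) 0 0).
Proof.
have mxD (A B : 'M[F]_1) : (A + B) 0 0 = A 0 0 + B 0 0 by rewrite mxE.
have mxN (A : 'M[F]_1) : (- A) 0 0 = - A 0 0 by rewrite mxE.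
have mxZ c (A : 'M[F]_1) : (c *: A) 0 0 = c * A 0 0 by rewrite mxE.
rewrite trmxB trmxZ !(mulmxDl, mulmxDr, mulNmx, mulmxN) -!(scalemxAl, scalemxAr).
rewrite !(mxD, mxN, mxZ).
(* The eight bilinear values become atoms of a polynomial identity in [k], which is later the
   imaginary unit. *)
move: (_ 0 0) (_ 0 0) (_ 0 0) (_ 0 0) (_ 0 0) (_ 0 0) (_ 0 0) (_ 0 0) => *.
ring.
Qed.

(** For z = x + iy, symmetry of [G] and skewness of [Omega] cancel the imaginary part of z^* (G + i
    Omega) z; its real part is the difference of the two sides of domination. *)
Lemma quantum_CM_dominated (R : rcfType) S (G : 'M[R]_(S.*2)) :
  quantum_CM G -> dominated (Omega R S) G.
Proof.
case=> GT [_ [_ psd]] x y.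
pose C m n := map_mx (fun a : R => a%:C%C) : 'M[R]_(m, n) -> 'M[R[i]]_(m, n).
have conjC m n (M : 'M[R]_(m, n)) : map_mx Num.conj (C _ _ M) = C _ _ M.
  by apply/matrixP => i j; rewrite !mxE; apply/CrealP; rewrite complex_real.
have conjz : map_mx Num.conj (C _ _ x + 'i *: C _ _ y) = C _ _ x - 'i *: C _ _ y.
  by rewrite map_mxD map_mxZ !conjC /= conjCi scaleNr.
have Cdot M u v : ((C _ _ u)^T *m C _ _ M *m C _ _ v) 0 0 = (dot u (M *m v))%:C%C.
  by rewrite /C map_trmx -!map_mxM mxE -mulmxA dot_mxE.
have : 0 <= ((C _ _ x - 'i *: C _ _ y)^T *m (C _ _ G + 'i *: C _ _ (Omega R S))
    *m (C _ _ x + 'i *: C _ _ y)) 0 0 by rewrite -conjz; exact: psd.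
clearbody C; rewrite mulmx_conjugate_expand.
rewrite !Cdot !(skew_dot _ (Omega_skew R S)).
have -> : dot y (G *m x) = dot x (G *m y) by rewrite dot_mulmx GT dotC.
have -> : dot y (Omega R S *m x) = - dot x (Omega R S *m y).
  by rewrite dot_mulmx Omega_skew mulNmx dotNl dotC.
rewrite sqrCi; set a := dot x (G *m x); set b := dot y (G *m y).
set c := dot x (Omega R S *m y); set d := dot x (G *m y).
rewrite (_ : _ + _ = (a + b - 2 * c)%:C%C) ?lecR; first by lra.
by rewrite !(rmorphB, rmorphD, rmorphN, rmorphM, rmorph0, rmorph_nat) /=; ring.
Qed.

Lemma quantum_CM_eigen_gt0 (R : rcfType) S (G : 'M[R]_(S.*2)) Lam :
  quantum_CM G -> spectrum_of G Lam -> forall i, 0 < Lam i.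
Proof.
case=> GT [Gpos _] [_ Gchar] i.
have : root (char_poly G) (Lam i).
  by rewrite Gchar (bigD1 i) //= rootM root_XsubC eqxx.
case/(unit_eigenvector GT) => u u1 Gu.
have u0 : u != 0 by rewrite -dot_eq0 u1 oner_neq0.
by have := Gpos u u0; rewrite -mulmxA Gu dot_mxE dotZr u1 mulr1.
Qed.

Lemma quantum_CM_antidiagonal_ge1 (R : rcfType) S (G : 'M[R]_(S.*2)) Lam :
  quantum_CM G -> spectrum_of G Lam -> forall i, 1 <= Lam i * Lam (rev_ord i).
Proof.
move=> Gq Gspec; have [Q Qo QG] := real_spectral Gq.1 Gspec.2.
have Kdom := dominated_congruence Q (quantum_CM_dominated Gq); rewrite QG in Kdom.
apply: antidiagonal_ge1 Kdom Gspec.1 (quantum_CM_eigen_gt0 Gq Gspec).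
apply: orthogonal_mxM => //; apply: orthogonal_mxM; last exact: Omega_orthogonal.
exact: orthogonal_mx_tr.
Qed.

Theorem theorem1 (R : realType) (S : nat) (hS : (1 <= S)%N)
    (G G' : 'M[R]_(S.*2)) (Lam : 'I_(S.*2) -> R) :
  quantum_CM G -> quantum_CM G' ->
  spectrum_of G Lam -> spectrum_of G' Lam ->
  t_pure_unique_pairing S.-1 Lam ->
  exists W : 'M[R]_(S.*2), SpO W /\ G' = W *m G *m W^T.
Proof.
move=> Gq Gq' Gspec Gspec' Lpure.
have Lpos := quantum_CM_eigen_gt0 Gq Gspec.
have impure := antidiagonal_impure_unique (quantum_CM_antidiagonal_ge1 Gq Gspec) Lpure.
(* A single [D] serves both matrices, since it is determined before either is given. *)
have [D nf] := normal_form impure Lpos.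
have skew := Omega_skew R S; have orth := Omega_orthogonal R S.
have [Q [Qo QJ QG]] := nf _ _ skew orth Gq.1 (quantum_CM_dominated Gq) Gspec.
have [Q' [Qo' QJ' QG']] := nf _ _ skew orth Gq'.1 (quantum_CM_dominated Gq') Gspec'.
have cancelQ (P M : 'M[R]_(S.*2)) : orthogonal_mx P -> P *m (P^T *m M *m P) *m P^T = M.
  by move=> /mulmx1C PP; rewrite !mulmxA PP mul1mx -mulmxA PP mulmx1.
(* [Q^T] brings [G] to [D] and [Q'] brings [D] to [G']; both congruences fix [Omega], so the
   composite is symplectic. *)
exists (Q' *m Q^T); split; first split.
- exact: orthogonal_mxM Qo' (orthogonal_mx_tr Qo).
- rewrite /symplectic.
  have -> : (Q' *m Q^T)^T *m Omega R S *m (Q' *m Q^T) = Q *m (Q'^T *m Omega R S *m Q') *m Q^T.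
    by rewrite trmx_mul trmxK !mulmxA.
  by rewrite QJ' -QJ cancelQ.
- rewrite -[LHS](cancelQ Q') // QG' -QG.
  by rewrite trmx_mul trmxK !mulmxA.
Qed.
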